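(* Assume that $\mathfrak h$ is finite-dimensional and that the auxiliary map $\mathfrak L$ is irreducible, with unique invariant state $\rho^{\mathrm{inv}}$, and let $m=\sum_{s\in S}\mathrm{Tr}(L_s\rho^{\mathrm{inv}}L_s^* )\,s$. Then, for any initial state $\rho=\sum_{i\in V}\rho(i)\otimes|i\rangle\langle i|$, the process $\big(\frac1p(X_p-X_0)\big)_{p}$ associated with $\mathfrak M$ converges exponentially to $m$: for any $\varepsilon>0$ there exists $N>0$ such that, for all large enough $p$, $$\mathbb P_\rho\Big(\Big\|\frac{X_p-X_0}p-m\Big\|>\varepsilon\Big)\leq e^{-pN}.$$ Consequently, $\big(\frac{X_p}p\big)_p$ converges $\mathbb P_\rho$-almost surely to $m$.
   Context: Let $V\subset\mathbb R^d$ be a locally finite lattice (a subgroup of $\mathbb R^d$ with finitely many points in every bounded set), and let $S\subset V$, $S\neq\{0\}$, be a finite set that positively generates $V$: every $v\in V$ can be written $v=s_1+\dots+s_n$ with $s_1,\dots,s_n\in S$. Let $\mathfrak h$ be a nonzero separable complex Hilbert space and $(L_s)_{s\in S}$ bounded operators on $\mathfrak h$ with $\sum_{s\in S}L_s^*L_s=\mathrm{Id}$. $\mathcal I_1(\cdot)$ denotes trace-class operators; a state is a positive trace-class operator of trace one. The (homogeneous) open quantum random walk is the map on $\mathcal I_1(\mathfrak h\otimes\mathbb C^V)$ (here $\mathbb C^V$ denotes the Hilbert space with orthonormal basis $(|i\rangle)_{i\in V}$) given by $\mathfrak M(\rho)=\sum_{j\in V}\sum_{s\in S}(L_s\otimes|j+s\rangle\langle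 j|)\,\rho\,(L_s^*\otimes|j\rangle\langle j+s|)$. Its auxiliary map is the map on $\mathcal I_1(\mathfrak h)$ given by $\mathfrak L(\rho)=\sum_{s\in S}L_s\rho L_s^*$. $\mathfrak L$ is irreducible if the only orthogonal projections $P$ on $\mathfrak h$ with $\mathfrak L(P\mathcal I_1(\mathfrak h)P)\subset P\mathcal I_1(\mathfrak h)P$ are $0$ and $\mathrm{Id}$; equivalently, the only closed subspaces of $\mathfrak h$ invariant under all $L_s$ are $\{0\}$ and $\mathfrak h$. When $\mathfrak h$ is finite-dimensional and $\mathfrak L$ is irreducible, $\mathfrak L$ has a unique invariant state $\rho^{\mathrm{inv}}$. Position process: for an initial state $\rho=\sum_{i\in V}\rho(i)\otimes|i\rangle\langle i|$ on $\mathfrak h\otimes\mathbb C^V$ (so $\rho(i)\geq0$ and $\sum_i\mathrm{Tr}\,\rho(i)=1$), let $\mathbb P_\rho$ be the unique probability on $V^{\mathbb N}$, with coordinate maps $(X_p)_{p\in\mathbb N}$, such that $$\mathbb P_\rho(X_0=i_0,\dots,X_p=i_p)=\mathrm{Tr}\big(L_{s_p}\cdots L_{s_1}\,\rho(i_0)\,L_{s_1}^*\cdots L_{s_p}^*\big)$$ if $s_k:=i_k-i_{k-1}\in S$ for $k=1,\dots,p$, and $0$ otherwise. *)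

(* Defs.v *)
From HB Require Import structures.
From mathcomp Require Import all_boot all_order all_algebra finmap.
From mathcomp Require Import complex.
From mathcomp Require Import all_classical all_reals all_analysis.
Set Implicit Arguments.
Unset Strict Implicit.
Unset Printing Implicit Defensive.
Import Order.TTheory GRing.Theory Num.Theory.
Import numFieldNormedType.Exports.
Local Open Scope classical_set_scope.
Local Open Scope ring_scope.
Local Open Scope sesquilinear_scope.
Local Open Scope complex_scope.

Definition enorm (R : realType) (d : nat) (x : 'rV[R]_d) : R :=
  Num.sqrt (\sum_(i < d) x 0 i ^+ 2).

(* [bounded_set] refers to the sup norm of 'rV[R]_d, which has the same bounded
   sets as the Euclidean norm. *)
Record lattice (R : realType) (d : nat) := Lattice {
  lattice_set :> set 'rV[R]_d;
  lattice0 : lattice_set 0;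
  latticeB : forall x y, lattice_set x -> lattice_set y -> lattice_set (x - y);
  lattice_locally_finite :
    forall B : set 'rV[R]_d, bounded_set B -> finite_set (lattice_set `&` B)
}.

Definition vertex (R : realType) (d : nat) (V : lattice R d) : Type :=
  set_type (lattice_set V).

HB.instance Definition _ (R : realType) (d : nat) (V : lattice R d) :=
  Choice.on (vertex V).

HB.instance Definition _ (R : realType) (d : nat) (V : lattice R d) :=
  isPointed.Build (vertex V) (exist _ 0 (mem_set (lattice0 V))).

Definition pos (R : realType) (d : nat) (V : lattice R d) (v : vertex V) :
  'rV[R]_d := sval v.

Definition positively_generates (R : realType) (d : nat)
    (S : {fset 'rV[R]_d}) (V : set 'rV[R]_d) : Prop :=
  forall v, V v ->
    exists2 t : seq 'rV[R]_d, {subset t <= S} & v = \sum_(s <- t) s.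

(* A finite-dimensional complex Hilbert space is modelled as C^n with its
   standard inner product: operators, all of them trace-class, are n x n complex
   matrices, and the adjoint is the conjugate transpose. *)
Section Operators.
Variables (R : realType) (n : nat).
Local Notation op := 'M[R[i]]_n.

(* On R[i], [0 <= z] says that z is real and nonnegative; so this is
   positivity of the operator, self-adjointness included. *)
Definition positive_op (A : op) : Prop :=
  forall x : 'cV[R[i]]_n, 0 <= (x ^t* *m A *m x) 0 0.

Definition is_state (A : op) : Prop := positive_op A /\ \tr A = 1.

Definition orthogonal_projection (P : op) : Prop :=
  P *m P = P /\ P ^t* = P.

Definition irreducible (Phi : op -> op) : Prop :=
  forall P : op, orthogonal_projection P ->
    (forall A : op, exists B : op, Phi (P *m A *m P) = P *m B *m P) ->
    P = 0 \/ P = 1%:M.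

End Operators.

(* Only the values of L on S matter. *)
Section OpenQuantumRandomWalk.
Variables (R : realType) (d n : nat) (S : {fset 'rV[R]_d}).
Variable L : 'rV[R]_d -> 'M[R[i]]_n.

Definition auxiliary_map (rho : 'M[R[i]]_n) : 'M[R[i]]_n :=
  \sum_(s <- S) L s *m rho *m (L s) ^t*.

Definition mean_drift (rho : 'M[R[i]]_n) : 'rV[R]_d :=
  \sum_(s <- S) complex.Re (\tr (L s *m rho *m (L s) ^t*)) *: s.

Variable V : lattice R d.

(* The state \sum_i rho i (x) |i><i|, given by its diagonal blocks. *)
Definition diagonal_state (rho : vertex V -> 'M[R[i]]_n) : Prop :=
  (forall i, positive_op (rho i)) /\
  (\esum_(i in [set: vertex V]) (complex.Re (\tr (rho i)))%:E = 1)%E.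

(* [step i k] is s_(k+1) = i_(k+1) - i_k. *)
Definition step (i : nat -> vertex V) (k : nat) : 'rV[R]_d :=
  pos (i k.+1) - pos (i k).

(* L_(s_p) ... L_(s_1) (rho i_0) L_(s_1)^* ... L_(s_p)^* *)
Fixpoint path_block (rho : vertex V -> 'M[R[i]]_n) (i : nat -> vertex V)
    (p : nat) : 'M[R[i]]_n :=
  match p with
  | 0 => rho (i 0)
  | k.+1 => L (step i k) *m path_block rho i k *m (L (step i k)) ^t*
  end.

Definition path_weight (rho : vertex V -> 'M[R[i]]_n) (i : nat -> vertex V)
    (p : nat) : R :=
  if [forall k : 'I_p, step i k \in S]
  then complex.Re (\tr (path_block rho i p)) else 0.

End OpenQuantumRandomWalk.

Section Trajectories.
Variables (R : realType) (d : nat) (V : lattice R d).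

(* V^N with the product sigma-algebra: V is countable and discrete, so that the
   latter is generated by the events [X_p = v]. *)
Definition coordinate_events : set (set (nat -> vertex V)) :=
  [set A | exists p v, A = [set w | w p = v]].

Local Notation trajectory := (g_sigma_algebraType coordinate_events).

Definition X (p : nat) (w : trajectory) : 'rV[R]_d := pos (w p).

(* P is P_rho: the paths are indexed by all of nat, but only i 0, ..., i p
   matter. *)
Definition position_law (n : nat) (S : {fset 'rV[R]_d})
    (L : 'rV[R]_d -> 'M[R[i]]_n) (rho : vertex V -> 'M[R[i]]_n)
    (P : probability trajectory R) : Prop :=
  forall (p : nat) (i : nat -> vertex V),
    (P [set w : trajectory | forall k, (k <= p)%N -> w k = i k] =
       (path_weight S L rho i p)%:E)%E.

End Trajectories.

Notation trajectory V := (g_sigma_algebraType (@coordinate_events _ _ V)).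

(* Main.v *)
(* By irreducibility the fixed points of the dual map
   A |-> sum_s (L s)^* A (L s) are the scalars: for a Hermitian fixed point A,
   the eigenspace of the least eigenvalue is invariant under all L s. Hence, for
   a real function f on S with mean zero under the invariant state, the Poisson
   equation Y - sum_s (L s)^* Y (L s) = sum_s f(s) (L s)^* (L s) has a solution.
   For small t > 0 the functional rho |-> Re tr ((1 + t Y) rho) is comparable to
   the trace on positive operators, and tilting one step of the walk by
   exp (t f(s)) multiplies it by at most 1 + O(t^2), the terms of order t
   cancelling by the Poisson equation. Chernoff's bound with f = the coordinates
   of s - m and of m - s gives the exponential estimate, and the Borel-Cantelli
   lemma the almost sure convergence. *)
Require Import Defs.
From HB Require Import structures.
From mathcomp Require Import all_boot all_order all_algebra finmap.
From mathcomp Require Import complex.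
From mathcomp Require Import all_classical all_reals all_analysis.
From mathcomp Require Import ring lra.
Set Implicit Arguments.
Unset Strict Implicit.
Unset Printing Implicit Defensive.
Import Order.TTheory GRing.Theory Num.Theory.
Import numFieldNormedType.Exports.
Local Open Scope classical_set_scope.
Local Open Scope ring_scope.
Local Open Scope sesquilinear_scope.
Local Open Scope complex_scope.

Lemma mxtrace_mul_conj (K : comPzRingType) (n : nat) (A B Y rho : 'M[K]_n) :
  \tr (A *m Y *m B *m rho) = \tr (Y *m (B *m rho *m A)).
Proof. by rewrite -!mulmxA mxtrace_mulC !mulmxA. Qed.

(** * Adjoints and spectra of complex matrices *)

Section Adjoint.
Variable C : numClosedFieldType.
Implicit Types m n p : nat.

Lemma trmxC_mul m n p (A : 'M[C]_(m, n)) (B : 'M[C]_(n, p)) :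
  (A *m B) ^t* = B ^t* *m A ^t*.
Proof. by rewrite trmx_mul map_mxM. Qed.

Lemma trmxCD m n (A B : 'M[C]_(m, n)) : (A + B) ^t* = A ^t* + B ^t*.
Proof. by rewrite linearD map_mxD. Qed.

Lemma trmxCN m n (A : 'M[C]_(m, n)) : (- A) ^t* = - A ^t*.
Proof. by rewrite linearN map_mxN. Qed.

Lemma trmxCZ m n (a : C) (A : 'M[C]_(m, n)) : (a *: A) ^t* = a^* *: A ^t*.
Proof. by rewrite linearZ /= map_mxZ. Qed.

Lemma trmxC_sum m n (I : Type) (r : seq I) (F : I -> 'M[C]_(m, n)) :
  (\sum_(i <- r) F i) ^t* = \sum_(i <- r) (F i) ^t*.
Proof. by rewrite linear_sum /= raddf_sum. Qed.

Lemma mxtrace_trmxC_mulE m n (A : 'M[C]_(m, n)) :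
  \tr (A ^t* *m A) = \sum_j \sum_i `|A i j| ^+ 2.
Proof.
apply: eq_bigr => j _; rewrite mxE; apply: eq_bigr => i _.
by rewrite !mxE mulrC -normCK.
Qed.

Lemma mxtrace_trmxC_mul_ge0 m n (A : 'M[C]_(m, n)) : 0 <= \tr (A ^t* *m A).
Proof.
rewrite mxtrace_trmxC_mulE; apply: sumr_ge0 => j _.
by apply: sumr_ge0 => i _; exact: exprn_ge0.
Qed.

Lemma mxtrace_trmxC_mul_eq0 m n (A : 'M[C]_(m, n)) :
  \tr (A ^t* *m A) = 0 -> A = 0.
Proof.
rewrite mxtrace_trmxC_mulE => /eqP.
rewrite psumr_eq0; last first.
  by move=> j _; apply: sumr_ge0 => i _; exact: exprn_ge0.
move=> /allP A0; apply/matrixP => i j; rewrite mxE.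
have := A0 j (mem_index_enum _); rewrite /= psumr_eq0; last first.
  by move=> k _; exact: exprn_ge0.
move=> /allP /(_ i (mem_index_enum _)) /=.
by rewrite expf_eq0 /= normr_eq0 => /eqP.
Qed.

Lemma sum_trmxC_mul_eq0 (T : eqType) (r : seq T) m n (F : T -> 'M[C]_(m, n)) :
  \sum_(i <- r) (F i) ^t* *m F i = 0 -> forall i, i \in r -> F i = 0.
Proof.
move=> /(congr1 mxtrace); rewrite mxtrace0 raddf_sum /= => /eqP.
rewrite psumr_eq0; last by move=> i _; exact: mxtrace_trmxC_mul_ge0.
by move=> /allP F0 i ri; apply/mxtrace_trmxC_mul_eq0/eqP/F0.
Qed.

(* The witnesses are the square root of [Y] minus its least eigenvalue, and the
   projection onto the corresponding eigenspace. *)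
Lemma least_eigenspace n (Y : 'M[C]_n) : (0 < n)%N -> Y ^t* = Y ->
  exists (a : C) (W P : 'M[C]_n),
  [/\ Y - a%:M = W ^t* *m W, P *m P = P /\ P ^t* = P, P <> 0, W *m P = 0 &
      forall M : 'M[C]_n, W *m M = 0 -> P *m M = M].
Proof.
move=> n_gt0 hY.
have Yherm : Y \is hermsymmx.
  by rewrite is_hermitianmxE expr0 scale1r hY.
have Yspec := orthomx_spectralP (hermitian_normalmx Yherm).
have /mxOverP Dreal := hermitian_spectral_diag_real Yherm.
set Q := spectralmx Y in Yspec; set D := spectral_diag Y in Yspec Dreal.
have Qu : Q \is unitarymx by exact: spectral_unitarymx.
have QQ : Q ^t* *m Q = 1%:M.
  by rewrite -invmx_unitary // mulVmx // spectral_unit.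
have QQ' : Q *m Q ^t* = 1%:M by apply/unitarymxP.
rewrite invmx_unitary // in Yspec.
have [i0 _ imin] := @real_arg_minP C 'I_n (Ordinal n_gt0) xpredT
  (fun i => D 0 i) isT (fun i _ => Dreal 0 i).
pose a := D 0 i0.
have Da_ge0 i : 0 <= D 0 i - a by rewrite subr_ge0 imin.
pose w := \row_i sqrtC (D 0 i - a).
pose e : 'rV[C]_n := \row_i (D 0 i == a)%:R.
exists a, (diag_mx w *m Q), (Q ^t* *m diag_mx e *m Q).
have ww : (diag_mx w) ^t* *m diag_mx w = diag_mx D - a%:M.
  rewrite tr_diag_mx map_diag_mx mulmx_diag -diag_const_mx -raddfB /=.
  congr diag_mx; apply/rowP => i; rewrite !mxE.
  have /CrealP -> : sqrtC (D 0 i - a) \is Num.real.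
    by rewrite ger0_real // sqrtC_ge0.
  by rewrite -expr2 sqrtCK.
have ee : diag_mx e *m diag_mx e = diag_mx e.
  rewrite mulmx_diag; congr diag_mx; apply/rowP => i; rewrite !mxE.
  by case: eqP; rewrite ?mul1r ?mul0r.
have we : diag_mx w *m diag_mx e = 0.
  rewrite mulmx_diag -(raddf0 (@diag_mx C n)); congr diag_mx.
  apply/rowP => i; rewrite !mxE.
  by case: (D 0 i =P a) => [->|_]; rewrite ?subrr ?sqrtC0 ?mul0r ?mulr0.
split.
- rewrite trmxC_mul mulmxA -(mulmxA (Q ^t*)) ww Yspec.
  rewrite mulmxBr mulmxBl; congr (_ - _).
  by rewrite -scalemx1 -scalemxAr -scalemxAl mulmx1 QQ scalemx1.
- split.
    rewrite !mulmxA -!mulmxA; congr (_ *m _).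
    by rewrite (mulmxA Q) QQ' mul1mx mulmxA ee.
  rewrite !trmxC_mul trmxCK mulmxA; congr (_ *m _ *m _).
  rewrite tr_diag_mx map_diag_mx; congr diag_mx; apply/rowP => i; rewrite !mxE.
  exact: rmorph_nat.
- move=> /(congr1 (fun M => Q *m M *m Q ^t*)).
  rewrite !mulmxA QQ' mul1mx -mulmxA QQ' mulmx1 mulmx0 mul0mx.
  move=> /matrixP /(_ i0 i0); rewrite !mxE !eqxx /= => /eqP.
  by rewrite oner_eq0.
- by rewrite !mulmxA -(mulmxA _ Q) QQ' mulmx1 we mul0mx.
move=> M WM0.
(* In the eigenbasis, [W *m M = 0] kills each row of [Q *m M] whose eigenvalue differs from [a], and
   [diag_mx e] keeps exactly the other rows. *)
suff eQM : diag_mx e *m (Q *m M) = Q *m M.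
  by rewrite -!mulmxA eQM mulmxA QQ mul1mx.
apply/matrixP => i j; rewrite mul_diag_mx !mxE.
have /matrixP /(_ i j) := WM0; rewrite -mulmxA mul_diag_mx !mxE.
case: (D 0 i =P a) => [_ _|/eqP neq /eqP]; first by rewrite mul1r.
rewrite mulf_eq0 sqrtC_eq0 subr_eq0 (negbTE neq) /= => /eqP ->.
by rewrite mulr0.
Qed.

End Adjoint.

(** Rank-nullity: the kernel of [f] is at most a line, so its range has codimension at most one; it
    lies in the hyperplane [g = 0], hence fills it. *)
Lemma linear_onto_ker_form (K : fieldType) (U : vectType K)
    (f : {linear U -> U}) (g : {linear U -> K^o}) (e : U) :
    (forall x, f x = 0 -> exists a, x = a *: e) ->
    (exists x, g x <> 0) -> (forall x, g (f x) = 0) ->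
  forall y, g y = 0 -> exists x, f x = y.
Proof.
move=> kerf [x0 gx0] gf y gy.
have ker_f : (\dim (lker (linfun f)) <= 1)%N.
  have : (lker (linfun f) <= <[e]>)%VS.
    apply/subvP => x; rewrite memv_ker lfunE /= => /eqP /kerf [a ->].
    by apply/vlineP; exists a.
  by move=> /dimvS /leq_trans; apply; rewrite dim_vline leq_b1.
have img_g : (0 < \dim (limg (linfun g)))%N.
  rewrite lt0n dimv_eq0; apply/eqP => g0; apply: gx0.
  have := memv_img (linfun g) (memvf x0).
  by rewrite g0 memv0 lfunE /= => /eqP.
have sub : (limg (linfun f) <= lker (linfun g))%VS.
  by apply/subvP => _ /memv_imgP [x _ ->]; rewrite memv_ker !lfunE /= gf.
have df := limg_ker_dim (linfun f) fullv; rewrite capfv in df.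
have dg := limg_ker_dim (linfun g) fullv; rewrite capfv in dg.
have : y \in limg (linfun f).
  have /eqP -> : limg (linfun f) == lker (linfun g).
    rewrite eqEdim sub /= -(leq_add2r (\dim (limg (linfun g)))) dg -df addnC.
    by rewrite leq_add2l (leq_trans ker_f).
  by rewrite memv_ker lfunE /= gy.
by move=> /memv_imgP [x _ ->]; exists x; rewrite lfunE.
Qed.

(** * The Poisson equation *)

Section DualMap.
Variables (C : numClosedFieldType) (T : eqType) (n : nat) (S : seq T).
Variable L : T -> 'M[C]_n.
Implicit Types A B rho : 'M[C]_n.

Definition dual_map A : 'M[C]_n := \sum_(s <- S) (L s) ^t* *m A *m L s.

Lemma dual_mapD A B : dual_map (A + B) = dual_map A + dual_map B.
Proof.
by rewrite -big_split; apply: eq_bigr => s _; rewrite mulmxDr mulmxDl.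
Qed.

Lemma dual_mapZ a A : dual_map (a *: A) = a *: dual_map A.
Proof.
by rewrite scaler_sumr; apply: eq_bigr => s _; rewrite -scalemxAr -scalemxAl.
Qed.

Lemma dual_mapC A : dual_map (A ^t*) = (dual_map A) ^t*.
Proof.
rewrite trmxC_sum; apply: eq_bigr => s _.
by rewrite !trmxC_mul trmxCK mulmxA.
Qed.

Lemma mxtrace_dual_map A rho :
  \tr ((\sum_(s <- S) L s *m rho *m (L s) ^t*) *m A) = \tr (rho *m dual_map A).
Proof.
rewrite mulmx_suml mulmx_sumr !raddf_sum; apply: eq_bigr => s _ /=.
by rewrite -!mulmxA mxtrace_mulC !mulmxA.
Qed.

Hypothesis n_gt0 : (0 < n)%N.
Hypothesis L_norm : \sum_(s <- S) (L s) ^t* *m L s = 1%:M.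
Hypothesis L_irr : forall P : 'M[C]_n, P *m P = P -> P ^t* = P ->
  (forall s, s \in S -> P *m (L s *m P) = L s *m P) -> P = 0 \/ P = 1%:M.

Lemma dual_map_scalar (a : C) : dual_map a%:M = a%:M.
Proof.
rewrite -[in RHS]scalemx1 -L_norm -scalemx1 dual_mapZ; congr (_ *: _).
by apply: eq_bigr => s _; rewrite mulmx1.
Qed.

(** Subtracting the least eigenvalue [a] leaves a fixed point [W^* W]. Compressed by the
    eigenprojection [P], the fixed-point equation says that the sum of the [(W L_s P)^* (W L_s P)]
    is zero, so each [W L_s P] vanishes: the eigenspace is invariant, and irreducibility makes it
    the whole space. *)
Lemma dual_map_fixed_hermitian A :
  A ^t* = A -> dual_map A = A -> exists a : C, A = a%:M.
Proof.
move=> hA fA.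
have [a [W [P [eW [PP hP] P0 WP maxP]]]] := least_eigenspace n_gt0 hA.
exists a; suff P1 : P = 1%:M.
  by move: WP; rewrite P1 mulmx1 => W0; apply/subr0_eq; rewrite eW W0 mulmx0.
have invP s : s \in S -> P *m (L s *m P) = L s *m P.
  move=> sS; apply: maxP; rewrite mulmxA.
  apply: (@sum_trmxC_mul_eq0 _ T S _ _ (fun s => W *m L s *m P)) sS.
  transitivity (P *m dual_map (A - a%:M) *m P).
    rewrite mulmx_sumr mulmx_suml; apply: eq_bigr => s' _.
    by rewrite eW !trmxC_mul hP !mulmxA.
  rewrite dual_mapD fA -scaleN1r dual_mapZ dual_map_scalar scaleN1r eW.
  by rewrite -!mulmxA WP !mulmx0.
by case: (L_irr PP hP invP).
Qed.

Lemma dual_map_fixed A : dual_map A = A -> exists a : C, A = a%:M.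
Proof.
move=> fA.
have fAC : dual_map (A ^t*) = A ^t* by rewrite dual_mapC fA.
have [||a ea] := @dual_map_fixed_hermitian (A + A ^t*).
- by rewrite trmxCD trmxCK addrC.
- by rewrite dual_mapD fA fAC.
have [||b eb] := @dual_map_fixed_hermitian ('i *: (A - A ^t*)).
- rewrite trmxCZ trmxCD trmxCN trmxCK conjCi.
  by rewrite scaleNr -scalerN opprB.
- by rewrite dual_mapZ -scaleN1r dual_mapD dual_mapZ fA fAC scaleN1r.
exists (2%:R^-1 * (a - 'i * b)); rewrite -scalemx1 -scalerA scalerBl.
have -> : A = 2%:R^-1 *: (A + A ^t* - 'i *: ('i *: (A - A ^t*))).
  rewrite scalerA -expr2 sqrCi scaleN1r opprK addrACA subrr addr0.
  by rewrite -mulr2n -[A *+ 2]scaler_nat scalerA mulVf ?scale1r ?pnatr_eq0.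
by rewrite ea eb -(scalemx1 _ a) -(scalemx1 _ b) !scalerA.
Qed.

(* Fredholm alternative: the range of [Id - dual_map] has codimension one, like
   the annihilator of the invariant state that contains it. *)
Lemma poisson_equation rho A :
    \tr rho <> 0 -> \sum_(s <- S) L s *m rho *m (L s) ^t* = rho ->
    \tr (rho *m A) = 0 ->
  exists Y, Y - dual_map Y = A.
Proof.
move=> tr_neq0 frho trA.
pose f (Y : 'M[C]_n) := Y - dual_map Y.
have f_lin : linear f.
  move=> k x y; rewrite /f dual_mapD dual_mapZ scalerBr.
  by rewrite opprD addrACA.
pose g (Y : 'M[C]_n) : C^o := \tr (rho *m Y).
have g_lin : linear g.
  by move=> k x y; rewrite /g mulmxDr mxtraceD -scalemxAr mxtraceZ.
pose fL := GRing.isLinear.Build _ _ _ _ f f_lin.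
pose gL := GRing.isLinear.Build _ _ _ _ g g_lin.
pose F : {linear 'M[C]_n -> 'M[C]_n} := HB.pack f fL.
pose G : {linear 'M[C]_n -> C^o} := HB.pack g gL.
have [|||Y eY] := @linear_onto_ker_form _ _ F G 1%:M _ _ _ A trA.
- move=> Y /subr0_eq /esym /dual_map_fixed [a ->].
  by exists a; rewrite scalemx1.
- by exists 1%:M; rewrite /= /g mulmx1.
- by move=> Y; rewrite /= /g /f mulmxBr raddfB /= -mxtrace_dual_map frho subrr.
by exists Y.
Qed.

End DualMap.

(** Passage from irreducibility in terms of projections to invariant subspaces: if [P L_s P = L_s P]
    for all [s], the image of [P B P] is unchanged by compression with [P], so it serves as its own
    witness. *)
Lemma irreducible_invariant (R : realType) (d n : nat) (S : {fset 'rV[R]_d})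
    (L : 'rV[R]_d -> 'M[R[i]]_n) (P : 'M[R[i]]_n) :
    irreducible (auxiliary_map S L) -> P *m P = P -> P ^t* = P ->
    (forall s, s \in S -> P *m (L s *m P) = L s *m P) ->
  P = 0 \/ P = 1%:M.
Proof.
move=> L_irr PP hP invP; apply: (L_irr _ (conj PP hP)) => B.
exists (auxiliary_map S L (P *m B *m P)).
rewrite mulmx_sumr mulmx_suml; apply: eq_big_seq => s sS.
have eP : P *m (L s) ^t* *m P = P *m (L s) ^t*.
  have := congr1 (fun M => M ^t*) (invP s sS).
  by rewrite !trmxC_mul hP.
have eP' : P *m L s *m P = L s *m P by rewrite -mulmxA invP.
by rewrite !mulmxA eP' -!(mulmxA _ P) -(mulmxA _ _ P) eP.
Qed.

(** * Real traces and positive operators *)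

Lemma Re_sum (R : realType) (T : Type) (r : seq T) (F : T -> R[i]) :
  complex.Re (\sum_(i <- r) F i) = \sum_(i <- r) complex.Re (F i).
Proof.
elim: r => [|x r IH]; first by rewrite !big_nil.
by rewrite !big_cons -IH; case: (F x) (\sum_(i <- r) F i) => a b [].
Qed.

Section RealTrace.
Variables (R : realType) (n : nat).
Implicit Types A B rho : 'M[R[i]]_n.

Definition retr A : R := complex.Re (\tr A).

Lemma retrD A B : retr (A + B) = retr A + retr B.
Proof. by rewrite /retr mxtraceD; case: (\tr A) (\tr B) => [a b] []. Qed.

Lemma retr_sum (T : Type) (r : seq T) (F : T -> 'M[R[i]]_n) :
  retr (\sum_(i <- r) F i) = \sum_(i <- r) retr (F i).
Proof.
elim: r => [|x r IH]; first by rewrite !big_nil /retr mxtrace0.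
by rewrite !big_cons retrD IH.
Qed.

Lemma retrZ (a : R) A : retr (a%:C *: A) = a * retr A.
Proof.
by rewrite /retr mxtraceZ; case: (\tr A) => b c /=; rewrite mul0r subr0.
Qed.

(** A crude substitute for the operator norm: some finite constant controlling [retr (A *m rho)] by
    [retr rho] is enough. *)
Definition entry_norm A : R :=
  \sum_i \sum_j (`|complex.Re (A i j)| + `|complex.Im (A i j)|).

Lemma entry_norm_ge0 A : 0 <= entry_norm A.
Proof.
by apply: sumr_ge0 => i _; apply: sumr_ge0 => j _; rewrite addr_ge0.
Qed.

Lemma positive_op_conj A B : positive_op A -> positive_op (B *m A *m B ^t*).
Proof.
move=> A_ge0 x; have := A_ge0 (B ^t* *m x).
by rewrite trmxC_mul trmxCK !mulmxA.
Qed.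

Lemma positive_op_ge0 A i : positive_op A -> 0 <= A i i.
Proof.
move=> /(_ (delta_mx i 0)).
by rewrite trmx_delta map_delta_mx -rowE -colE !mxE.
Qed.

Lemma positive_op_diag A i : positive_op A ->
  complex.Im (A i i) = 0 /\ 0 <= complex.Re (A i i) <= retr A.
Proof.
move=> A_ge0.
have pos k : complex.Im (A k k) = 0 /\ 0 <= complex.Re (A k k).
  have := positive_op_ge0 k A_ge0; rewrite lecE /= => /andP[/eqP -> ->].
  by [].
rewrite /retr Re_sum.
have [-> re_ge0] := pos i; split; rewrite // re_ge0 (bigD1 i) //= lerDl.
by apply: sumr_ge0 => k _; have [] := pos k.
Qed.

Lemma retr_ge0 A : positive_op A -> 0 <= retr A.
Proof.
move=> A_ge0.
rewrite /retr Re_sum.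
by apply: sumr_ge0 => k _; have [_ /andP[]] := positive_op_diag k A_ge0.
Qed.

(** This is the quadratic form of [A] at e_i + w e_j, expanded. *)
Lemma positive_op_pair A i j (w : R[i]) : positive_op A ->
  0 <= A i i + w * A i j + w^* * A j i + w^* * w * A j j.
Proof.
move=> /(_ (delta_mx i 0 + w *: delta_mx j 0)).
have e k l : (delta_mx 0 k : 'rV_n) *m A *m (delta_mx l 0 : 'cV_n) = (A k l)%:M.
  by rewrite -rowE -colE; apply/matrixP => a b; rewrite !ord1 !mxE mulr1n.
rewrite trmxCD trmxCZ !trmx_delta !map_delta_mx.
rewrite !(mulmxDl, mulmxDr) -!(scalemxAl, scalemxAr) !e !mxE !mulr1n.
by rewrite -!addrA (addrCA _ (w * A i j)) !mulrA.
Qed.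

(* Positivity of the quadratic form at e_i + w e_j for w = 1, -1, i, -i. *)
Lemma positive_op_entry A i j : positive_op A ->
  `|complex.Re (A i j)| <= retr A /\ `|complex.Im (A i j)| <= retr A.
Proof.
move=> A_ge0.
have [im_i re_i] := positive_op_diag i A_ge0.
have [im_j re_j] := positive_op_diag j A_ge0.
have := positive_op_pair i j 1 A_ge0.
have := positive_op_pair i j (-1) A_ge0.
have := positive_op_pair i j (Complex 0 1) A_ge0.
have := positive_op_pair i j (Complex 0 (-1)) A_ge0.
case: (A i i) im_i re_i => a1 b1 /= -> re_i.
case: (A j j) im_j re_j => a2 b2 /= -> re_j.
case: (A i j) => a b; case: (A j i) => a' b'.
rewrite !lecE /=.
move=> /andP[/eqP h1 h1'] /andP[/eqP h2 h2'].
move=> /andP[/eqP h3 h3'] /andP[/eqP h4 h4'].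
move: re_i re_j => /andP[p1 p2] /andP[q1 q2].
by rewrite !ler_norml; split; apply/andP; split; lra.
Qed.

(** The trace of the product is bilinear in the entries, and those of a positive [rho] have real and
    imaginary parts bounded by its trace. *)
Lemma retr_mul_le A rho : positive_op rho ->
  `|retr (A *m rho)| <= entry_norm A * retr rho.
Proof.
move=> rho_ge0.
have -> : retr (A *m rho) = \sum_i \sum_j
    (complex.Re (A i j) * complex.Re (rho j i)
     - complex.Im (A i j) * complex.Im (rho j i)).
  rewrite /retr Re_sum; apply: eq_bigr => i _; rewrite mxE Re_sum.
  by apply: eq_bigr => j _; case: (A i j) => a b; case: (rho j i) => a' b'.
rewrite mulr_suml (le_trans (ler_norm_sum _ _ _)) //; apply: ler_sum => i _.
rewrite mulr_suml (le_trans (ler_norm_sum _ _ _)) //; apply: ler_sum => j _.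
have [re_le im_le] := positive_op_entry j i rho_ge0.
rewrite mulrDl (le_trans (ler_normB _ _)) // !normrM.
by rewrite lerD // ler_wpM2l.
Qed.

End RealTrace.

(** * Scalar estimates for one tilted step *)

Lemma expR_le_quadratic (R : realType) (x : R) :
  `|x| <= 2^-1 -> expR x <= 1 + x + 2 * x ^+ 2.
Proof.
rewrite ler_norml => /andP[x_ge x_le].
have e1 := expR_ge1Dx (- x).
have e2 : expR x * expR (- x) = 1 by rewrite -expRD subrr expR0.
have e3 := expR_gt0 x.
have x1 : 0 < 1 - x by lra.
rewrite -(ler_pM2r x1).
(* Since [1 - x <= expR (- x)], it remains to see that the quadratic times [1 - x] is at least 1. *)
have /le_trans : expR x * (1 - x) <= 1 by rewrite -[leRHS]e2 ler_wpM2l // ltW.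
apply; rewrite -subr_ge0.
have -> : (1 + x + 2 * x ^+ 2) * (1 - x) - 1 = x ^+ 2 * (1 - 2 * x) by ring.
by rewrite mulr_ge0 ?sqr_ge0 //; lra.
Qed.

(** Here [a] and [y] stand for the traces of [L_s rho L_s^*] and of its product with [Y]. After the
    second-order bound on the exponential, the remainder is t^2 times [f y + 2 f^2 (a + t y)], and
    [a + t y <= 2 a] because [t c <= 1/2]. *)
Lemma tilt_step_scalar (R : realType) (t f m c a y : R) :
    0 <= t -> t * m <= 2^-1 -> t * c <= 2^-1 -> `|f| <= m -> 0 <= a ->
    `|y| <= c * a ->
  expR (t * f) * (a + t * y)
    <= a + t * (y + f * a) + (m * c + 4 * m ^+ 2) * t ^+ 2 * a.
Proof.
move=> t_ge0 tm tc fm a_ge0 ya.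
have ty : `|t * y| <= 2^-1 * a.
  rewrite normrM ger0_norm // (le_trans (ler_wpM2l t_ge0 ya)) // mulrA.
  exact: ler_wpM2r.
have tf : `|t * f| <= 2^-1.
  by rewrite normrM ger0_norm // (le_trans _ tm) // ler_wpM2l.
move: ty; rewrite ler_norml => /andP[ty1 ty2].
have h_ge0 : 0 <= a + t * y by lra.
apply: (le_trans (ler_wpM2r h_ge0 (expR_le_quadratic tf))).
have -> : (1 + t * f + 2 * (t * f) ^+ 2) * (a + t * y) =
    a + t * (y + f * a) + t ^+ 2 * (f * y + f ^+ 2 * (2 * (a + t * y))) by ring.
have -> : (m * c + 4 * m ^+ 2) * t ^+ 2 * a =
    t ^+ 2 * (m * (c * a) + m ^+ 2 * (4 * a)) by ring.
rewrite lerD2l ler_wpM2l ?sqr_ge0 // lerD //.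
  by rewrite (le_trans (ler_norm _)) // normrM ler_pM.
apply: ler_pM; rewrite ?sqr_ge0 ?mulr_ge0 //; last by lra.
by rewrite -real_normK ?num_real // lerXn2r ?nnegrE // (le_trans _ fm).
Qed.

(** * Exponential moments along the words of steps *)

Section ExponentialMoment.
Variables (R : realType) (n : nat) (T : eqType) (S : seq T).
Variables (L : T -> 'M[R[i]]_n) (f : T -> R) (Y : 'M[R[i]]_n).
Implicit Types rho : 'M[R[i]]_n.
Hypothesis L_norm : \sum_(s <- S) (L s) ^t* *m L s = 1%:M.
Hypothesis Y_poisson :
  Y - dual_map S L Y = \sum_(s <- S) (f s)%:C *: ((L s) ^t* *m L s).

(** For [t <= b] both [t m] and [t c] are at most 1/2; the summand 1 keeps the denominator positive.
    The factor 2 in [k] pays for replacing the trace by the tilted functional, which is at least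
    half of it. *)
Let c : R := entry_norm Y.
Let m : R := \sum_(s <- S) `|f s|.
Let b : R := 2^-1 / (m + c + 1).
Let k : R := 2 * (m * c + 4 * m ^+ 2).

Let c_ge0 : 0 <= c. Proof. exact: entry_norm_ge0. Qed.
Let m_ge0 : 0 <= m. Proof. by rewrite sumr_ge0. Qed.
Let k_ge0 : 0 <= k.
Proof. by rewrite !(mulr_ge0, addr_ge0) // sqr_ge0. Qed.
Let f_le s : s \in S -> `|f s| <= m.
Proof. by move=> sS; rewrite /m (big_rem s) //= lerDl sumr_ge0. Qed.

(** This is Re tr ((1 + t Y) rho). By the Poisson equation, [1 + t Y] is fixed up to O(t^2) by the
    dual map with weights [expR (t * f s)]. *)
Definition tilt (t : R) (rho : 'M[R[i]]_n) : R :=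
  retr rho + t * retr (Y *m rho).

Lemma retr_conj s rho :
  retr (L s *m rho *m (L s) ^t*) = retr ((L s) ^t* *m L s *m rho).
Proof. by rewrite /retr mxtrace_mulC !mulmxA. Qed.

Lemma sum_retr_conj rho :
  \sum_(s <- S) retr (L s *m rho *m (L s) ^t*) = retr rho.
Proof.
rewrite -[in RHS](mul1mx rho) -L_norm mulmx_suml retr_sum.
by apply: eq_bigr => s _; rewrite retr_conj.
Qed.

Lemma retr_poisson rho :
  retr (Y *m rho) = \sum_(s <- S) (retr (Y *m (L s *m rho *m (L s) ^t*))
                                   + f s * retr (L s *m rho *m (L s) ^t*)).
Proof.
have -> : retr (Y *m rho) = retr (dual_map S L Y *m rho) +
    retr ((\sum_(s <- S) (f s)%:C *: ((L s) ^t* *m L s)) *m rho).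
  by rewrite -retrD -mulmxDl -Y_poisson addrC subrK.
rewrite big_split /=; congr (_ + _).
  rewrite mulmx_suml retr_sum; apply: eq_bigr => s _.
  by rewrite /retr mxtrace_mul_conj.
rewrite mulmx_suml retr_sum; apply: eq_bigr => s _.
by rewrite -scalemxAl retrZ retr_conj.
Qed.

Let small (t : R) : 0 <= t <= b -> t * m <= 2^-1 /\ t * c <= 2^-1.
Proof.
move=> /andP[t_ge0]; rewrite ler_pdivlMr; last by rewrite ltr_wpDl // addr_ge0.
rewrite !mulrDr mulr1 => h.
have tm := mulr_ge0 t_ge0 m_ge0; have tc := mulr_ge0 t_ge0 c_ge0.
by split; lra.
Qed.

Lemma tilt_bounds t rho : 0 <= t <= b -> positive_op rho ->
  2^-1 * retr rho <= tilt t rho <= 2 * retr rho.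
Proof.
move=> tb rho_ge0; have [_ tc] := small tb; case/andP: tb => t_ge0 _.
have := retr_mul_le Y rho_ge0; have := retr_ge0 rho_ge0; rewrite -/c /tilt.
rewrite ler_norml => r_ge0 /andP[lo hi].
have tcr : t * c * retr rho <= 2^-1 * retr rho by rewrite ler_wpM2r.
have tlo := ler_wpM2l t_ge0 lo; have thi := ler_wpM2l t_ge0 hi.
by apply/andP; split; lra.
Qed.

(* The terms of order t cancel by the Poisson equation. *)
Lemma tilt_step t rho : 0 <= t <= b -> positive_op rho ->
  \sum_(s <- S) expR (t * f s) * tilt t (L s *m rho *m (L s) ^t*)
    <= (1 + k * t ^+ 2) * tilt t rho.
Proof.
move=> tb rho_ge0; have [tm tc] := small tb.
have [lo _] := andP (tilt_bounds tb rho_ge0).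
pose a s := retr (L s *m rho *m (L s) ^t*).
pose y s := retr (Y *m (L s *m rho *m (L s) ^t*)).
have -> : (1 + k * t ^+ 2) * tilt t rho =
    retr rho + t * retr (Y *m rho) + k * t ^+ 2 * tilt t rho.
  by rewrite /tilt; ring.
rewrite retr_poisson -[X in _ <= X + _ + _]sum_retr_conj.
apply: (@le_trans _ _ (\sum_(s <- S) (a s + t * (y s + f s * a s)
   + 2^-1 * k * t ^+ 2 * a s))).
  rewrite big_seq [X in _ <= X]big_seq; apply: ler_sum => s sS.
  have psd := positive_op_conj (L s) rho_ge0.
  rewrite /k (mulrA _ 2) mulVf ?pnatr_eq0 // mul1r.
  apply: tilt_step_scalar => //; last exact: retr_mul_le.
  - by case/andP: tb.
  - exact: f_le.
  - exact: retr_ge0.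
rewrite big_split /= big_split /= -!mulr_sumr (sum_retr_conj rho) lerD2l.
have -> : 2^-1 * k * t ^+ 2 * retr rho = k * t ^+ 2 * (2^-1 * retr rho) by ring.
by rewrite ler_wpM2l // mulr_ge0 ?sqr_ge0 // k_ge0.
Qed.

(* Steps are listed from the last one to the first. *)
Fixpoint word_block rho (l : seq T) : 'M[R[i]]_n :=
  if l is s :: l' then L s *m word_block rho l' *m (L s) ^t* else rho.

Fixpoint words (p : nat) : seq (seq T) :=
  if p is p'.+1 then [seq s :: l | l <- words p', s <- S] else [:: [::]].

Lemma positive_op_word rho l : positive_op rho -> positive_op (word_block rho l).
Proof. 
move=> rho_ge0; elim: l => [|s l IH]; first exact: rho_ge0.
exact: (positive_op_conj (L s) IH).
 Qed.

(** Induction on the length: a new last step is put at the head of each word, and [tilt_step]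
    applies to the block of the old word, which is positive. *)
Lemma exponential_moment t rho p : 0 <= t <= b -> positive_op rho ->
  \sum_(l <- words p) expR (t * \sum_(s <- l) f s) * tilt t (word_block rho l)
    <= (1 + k * t ^+ 2) ^+ p * tilt t rho.
Proof.
move=> tb rho_ge0; elim: p => [|p IH] /=.
  by rewrite big_seq1 big_nil mulr0 expR0 expr0 mul1r.
rewrite big_allpairs_dep /= exprS -mulrA.
apply: le_trans (ler_wpM2l _ IH); last by rewrite addr_ge0 // mulr_ge0 ?sqr_ge0.
rewrite mulr_sumr; apply: ler_sum => l _.
have eE s : expR (t * \sum_(x <- s :: l) f x) =
    expR (t * \sum_(x <- l) f x) * expR (t * f s).
  by rewrite big_cons mulrDr addrC expRD.
rewrite mulrCA; under eq_bigr do rewrite eE -mulrA.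
rewrite -mulr_sumr ler_wpM2l ?expR_ge0 //.
exact/tilt_step/positive_op_word.
Qed.

(* The parameter t of Chernoff's bound is chosen so that k t^2 <= t e / 2. *)
Lemma word_chernoff (e : R) : 0 < e ->
  exists2 N : R, 0 < N & forall rho p, positive_op rho ->
    \sum_(l <- words p | p%:R * e < \sum_(s <- l) f s) retr (word_block rho l)
      <= 4 * expR (- (p%:R * N)) * retr rho.
Proof.
move=> e_gt0.
have b_gt0 : 0 < b by rewrite divr_gt0 // ltr_wpDl // addr_ge0.
(* [k + 1] instead of [k] avoids a division by zero when [k] is 0. *)
pose u := e / (2 * (k + 1)).
have u_gt0 : 0 < u by rewrite divr_gt0 // mulr_gt0 // ltr_wpDl.
pose t := Num.min b u.
have t_gt0 : 0 < t by rewrite lt_min b_gt0.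
have tb : 0 <= t <= b by rewrite ltW //= ge_min lexx.
have tu : t * (2 * (k + 1)) <= e.
  by rewrite -ler_pdivlMr ?ge_min ?lexx ?orbT // mulr_gt0 // ltr_wpDl.
have kt : k * t ^+ 2 <= t * e / 2.
  have : t * (t * (2 * (k + 1))) <= t * e by rewrite ler_pM2l.
  have := sqr_ge0 t; lra.
exists (t * e / 2) => [|rho p rho_ge0]; first by rewrite divr_gt0 // mulr_gt0.
have tilt_ge0 l : 0 <= tilt t (word_block rho l).
  have psd := positive_op_word l rho_ge0.
  have /andP[lo _] := tilt_bounds tb psd.
  by rewrite (le_trans _ lo) // mulr_ge0 // retr_ge0.
(* Markov's inequality: on the selected words the exponential factors have product at least 1, and
   the trace is at most twice the tilted functional; the other words contribute nonnegative
   terms. *)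
apply: (@le_trans _ _ (\sum_(l <- words p) 2 * expR (- (p%:R * (t * e))) *
  (expR (t * \sum_(s <- l) f s) * tilt t (word_block rho l)))).
  rewrite big_mkcond; apply: ler_sum => l _; case: ifPn => [big_l|_]; last first.
    by rewrite !mulr_ge0 // expR_ge0.
  have psd := positive_op_word l rho_ge0.
  have /andP[lo _] := tilt_bounds tb psd.
  have h1 : 1 <= expR (- (p%:R * (t * e))) * expR (t * \sum_(s <- l) f s).
    rewrite -expRD -[leLHS]expR0 ler_expR addrC subr_ge0 mulrCA.
    by rewrite ler_pM2l // ltW.
  have h2 := ler_wpM2r (tilt_ge0 l) h1.
  by rewrite -mulrA (mulrA (expR _)); lra.
rewrite -mulr_sumr.
apply: le_trans (ler_wpM2l _ (exponential_moment p tb rho_ge0)) _.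
  by rewrite mulr_ge0 // expR_ge0.
have /andP[_ hi] := tilt_bounds tb rho_ge0.
(* The growth factor uses up half of the decay rate [t * e]; the other half remains. *)
have h1 : (1 + k * t ^+ 2) ^+ p <= expR (p%:R * (t * e / 2)).
  rewrite [p%:R * _]mulrC expRM_natr lerXn2r ?nnegrE ?expR_ge0 //.
    by rewrite addr_ge0 // mulr_ge0 ?sqr_ge0.
  by rewrite (le_trans (expR_ge1Dx _)) // ler_expR.
have -> : expR (- (p%:R * (t * e / 2))) =
    expR (- (p%:R * (t * e))) * expR (p%:R * (t * e / 2)).
  by rewrite -expRD; congr expR; field.
have h2 := ler_pM _ (tilt_ge0 [::]) h1 hi.
have h3 := ler_wpM2l (expR_ge0 (- (p%:R * (t * e)))) (h2 _).
rewrite -[leLHS]mulrA.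
have -> : 4 * (expR (- (p%:R * (t * e))) * expR (p%:R * (t * e / 2))) * retr rho =
  2 * (expR (- (p%:R * (t * e))) * (expR (p%:R * (t * e / 2)) * (2 * retr rho))).
  by ring.
rewrite ler_pM2l // h3 //.
by rewrite exprn_ge0 // addr_ge0 // mulr_ge0 ?sqr_ge0.
Qed.

End ExponentialMoment.

(** * Finite subadditivity and countability of the lattice *)

Lemma measure_bigsetU_le (d : measure_display) (T : measurableType d)
    (R : realType) (mu : {measure set T -> \bar R}) (I : Type) (r : seq I)
    (Q : pred I) (F : I -> set T) :
    (forall i, measurable (F i)) ->
  (mu (\big[setU/set0]_(i <- r | Q i) F i) <= \sum_(i <- r | Q i) mu (F i))%E.
Proof.
move=> mF; elim: r => [|i r IH]; first by rewrite !big_nil measure0.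
rewrite !big_cons; case: ifP => // _; apply: le_trans (leeD2l _ IH).
by apply: measureU2 => //; exact: bigsetU_measurable.
Qed.

(** By local finiteness the lattice is the union over [k] of its finite intersections with the balls
    of radius [k]. *)
Lemma vertex_countable (R : realType) (d : nat) (V : lattice R d) :
  exists g : vertex V -> nat, injective g.
Proof.
have /countable_injP [f f_inj] : countable (lattice_set V).
  have -> : lattice_set V = \bigcup_k (lattice_set V `&` [set x | `|x| <= k%:R]).
    apply/seteqP; split=> [x Vx|x [k _ []] //].
    exists (Num.truncn `|x|).+1 => //; split => //=.
    exact: (ltW (truncnS_gt _)).
  apply: bigcup_countable => // k _.
  apply/finite_set_countable/lattice_locally_finite.
  exists k%:R; split; rewrite ?num_real // => M kM x /= /le_trans; apply.
  exact: ltW.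
exists (fun v => f (sval v)) => v w fvw.
exact: val_inj (f_inj _ _ (svalP v) (svalP w) fvw).
Qed.

(** * Trajectories and cylinders *)

Section Cylinders.
Variables (R : realType) (d : nat) (V : lattice R d).
Implicit Types (w i : nat -> vertex V) (E : set (nat -> vertex V)).

Definition agree p w w' := forall k, (k <= p)%N -> w k = w' k.

Definition determined p E := forall w w', agree p w w' -> E w -> E w'.

Lemma measurable_cylinder p i :
  measurable ([set w | agree p w i] : set (trajectory V)).
Proof.
have -> : [set w | agree p w i] = \bigcap_(k in `I_p.+1) [set w | w k = i k].
  by apply/seteqP; split => w h k; exact: h.
apply: bigcap_measurableType => k _; apply: sub_sigma_algebra.
by exists k, (i k).
Qed.

(** The first p + 1 positions form a finite sequence over a countable set, so natural numbers can
    label the cylinders. This gives the countable partitions used below. *)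
Lemma trajectory_code p : exists c : (nat -> vertex V) -> nat,
  (forall w w', c w = c w' <-> agree p w w').
Proof.
have [g g_inj] := vertex_countable V.
exists (fun w => choice.pickle [seq g (w k) | k <- iota 0 p.+1]) => w w'; split.
  move=> /(pcan_inj (@choice.pickleK _)) /eq_in_map h k kp.
  by apply/g_inj/h; rewrite mem_iota.
move=> h; congr choice.pickle; apply/eq_in_map => k; rewrite mem_iota.
by rewrite add0n ltnS => kp; rewrite h.
Qed.

(** Each label cuts out of [E] either nothing or a whole cylinder, so [E] is a countable union of
    cylinders. *)
Lemma measurable_determined p E : determined p E ->
  measurable (E : set (trajectory V)).
Proof.
move=> detE; have [c cP] := trajectory_code p.
have -> : E = \bigcup_j (E `&` [set w | c w = j]).
  by apply/seteqP; split => [w Ew|w [j _ []]//]; exists (c w).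
apply: (@bigcupT_measurable _ (trajectory V)) => j.
have [[w0 [Ew0 <-]]|none] := pselect (exists w, E w /\ c w = j); last first.
  suff -> : E `&` [set w | c w = j] = set0 by exact: measurable0.
  by apply/seteqP; split => // w [Ew cw]; apply: none; exists w.
suff -> : E `&` [set w | c w = c w0] = [set w | agree p w w0].
  exact: measurable_cylinder.
apply/seteqP; split => w /=; first by case=> _ /cP.
move=> /cP cw; split=> //; apply: detE Ew0; exact/cP.
Qed.

Lemma measure0_determined p E (P : probability (trajectory V) R) :
    determined p E -> (forall i, E i -> P [set w | agree p w i] = 0%E) ->
  P E = 0%E.
Proof.
move=> detE P0; have [c cP] := trajectory_code p.
apply/(measure_negligible (measurable_determined detE)).
have -> : E = \bigcup_j (E `&` [set w | c w = j]).
  by apply/seteqP; split => [w Ew|w [j _ []]//]; exists (c w).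
apply: negligible_bigcup => j.
have [[w0 [Ew0 <-]]|none] := pselect (exists w, E w /\ c w = j); last first.
  suff -> : E `&` [set w | c w = j] = set0 by exact: negligible_set0.
  by apply/seteqP; split => // w [Ew cw]; apply: none; exists w.
exists [set w | agree p w w0]; split; first exact: measurable_cylinder.
  exact: P0.
by move=> w [_ /cP].
Qed.

(** The last step comes first, as in [word_block]. *)
Fixpoint step_word w p : seq 'rV[R]_d :=
  if p is p'.+1 then step w p' :: step_word w p' else [::].

Lemma step_word_sum w p : \sum_(s <- step_word w p) s = pos (w p) - pos (w 0).
Proof.
elim: p => [|p IH] /=; first by rewrite big_nil subrr.
by rewrite big_cons IH /step addrA subrK.
Qed.

Lemma size_step_word w p : size (step_word w p) = p.
Proof. by elim: p => //= p ->. Qed.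

Lemma step_word_agree p w w' : agree p w w' -> step_word w p = step_word w' p.
Proof.
elim: p => //= p IH h; congr (_ :: _); first by rewrite /step !h.
by apply: IH => k kp; apply/h/leqW.
Qed.

Lemma agree_step_word p w w' :
  w 0 = w' 0 -> step_word w p = step_word w' p -> agree p w w'.
Proof.
move=> h0; elim: p => [_ k|p IH /= [hs hw]] //; first by rewrite leqn0 => /eqP ->.
have hp := IH hw; move=> k; rewrite leq_eqVlt => /orP[/eqP ->|]; last exact: hp.
by apply/val_inj; move: hs; rewrite /step /pos (hp p (leqnn p)) => /addIr.
Qed.

Lemma mem_words (S : {fset 'rV[R]_d}) w p :
  (forall k, (k < p)%N -> step w k \in S) -> step_word w p \in words S p.
Proof.
elim: p => [//|p IH h] /=; apply: allpairs_f; last exact: (h p (ltnSn p)).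
by apply: IH => k kp; apply/h/leqW.
Qed.

Lemma path_block_word n (L : 'rV[R]_d -> 'M[R[i]]_n) rho w p :
  path_block L rho w p = word_block L (rho (w 0)) (step_word w p).
Proof. by elim: p => //= p ->. Qed.

End Cylinders.

(** * Bounds on events that depend on the word of steps *)

Section PositionLaw.
Variables (R : realType) (d n : nat) (V : lattice R d) (S : {fset 'rV[R]_d}).
Variables (L : 'rV[R]_d -> 'M[R[i]]_n) (rho : vertex V -> 'M[R[i]]_n).
Variable P : probability (trajectory V) R.
Hypothesis rho_ge0 : forall v, positive_op (rho v).
Hypothesis P_law : position_law S L rho P.

Lemma steps_not_in_S p :
  P [set w | ~ forall k, (k < p)%N -> step w k \in S] = 0%E.
Proof.
apply: (@measure0_determined _ _ _ p) => [w w' h nS S'|i niS].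
  apply: nS => k kp; rewrite /step !h ?(ltnW kp) //; exact: S'.
rewrite P_law /path_weight; case: ifPn => // /forallP iS.
by case: niS => k kp; have := iS (Ordinal kp).
Qed.

Lemma measurable_start_word p v l :
  measurable [set w : trajectory V | w 0%N = v /\ step_word w p = l].
Proof.
apply: (@measurable_determined _ _ _ p) => w w' h [<- <-].
by split; [rewrite h | rewrite (step_word_agree h)].
Qed.

(** The start and the word determine the path up to time [p], so the event lies in one cylinder.
    Only an inequality is claimed: the event is empty if no lattice path realizes the word, and null
    if a step is outside [S]. *)
Lemma start_word_le p v l :
  (P [set w : trajectory V | w 0%N = v /\ step_word w p = l]
    <= (retr (word_block L (rho v) l))%:E)%E.
Proof.
have block_ge0 : 0 <= retr (word_block L (rho v) l).
  exact/retr_ge0/positive_op_word.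
have [[i [iv il]]|none] :=
  pselect (exists w, w 0 = v /\ step_word w p = l); last first.
  rewrite (_ : [set w | _] = set0) ?measure0 ?lee_fin //.
  by apply/seteqP; split => // w h; apply: none; exists w.
apply: (@le_trans _ _ (P [set w | agree p w i])).
  apply: le_measure; rewrite ?inE.
  - exact: measurable_start_word.
  - exact: measurable_cylinder.
  - by move=> w [h0 hl]; apply: agree_step_word; rewrite ?h0 ?hl.
rewrite P_law /path_weight lee_fin; case: ifP => // _.
by rewrite path_block_word iv il.
Qed.

Lemma start_law v : P [set w : trajectory V | w 0%N = v] = (retr (rho v))%:E.
Proof.
have := P_law 0 (fun=> v); rewrite /path_weight /=.
have -> : [forall k : 'I_0, step (fun=> v) k \in S] by apply/forallP => -[].
move=> <-; congr (P _); apply/seteqP; split => w /=; last exact.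
by move=> wv k; rewrite leqn0 => /eqP ->.
Qed.

(** The event is split according to the starting vertex. The bound for each start is proportional to
    the probability of that start, so the sum over the possibly infinitely many starts is again
    [c]. *)
Lemma word_event_le p (Q : pred (seq 'rV[R]_d)) (c : R) :
    0 <= c ->
    (forall v, \sum_(l <- words S p | Q l) retr (word_block L (rho v) l)
                 <= c * retr (rho v)) ->
  (P [set w | Q (step_word w p)] <= c%:E)%E.
Proof.
move=> c_ge0 hQ; have [g g_inj] := vertex_countable V.
set E := [set w | _].
have mE : measurable (E : set (trajectory V)).
  apply: (@measurable_determined _ _ _ p) => w w' h.
  by rewrite /E /= (step_word_agree h).
have mstart j : measurable [set w : trajectory V | g (w 0%N) = j].
  by apply: (@measurable_determined _ _ _ 0) => w w' h /=; rewrite h.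
have start_le j : (P (E `&` [set w : trajectory V | g (w 0%N) = j])
    <= c%:E * P [set w | g (w 0%N) = j])%E.
  have [[v <-]|none] := pselect (exists v, g v = j); last first.
    rewrite (_ : [set w : trajectory V | g (w 0%N) = j] = set0).
      by rewrite setI0 measure0 mule0.
    by apply/seteqP; split => // w /= wj; apply: none; exists (w 0%N).
  have -> : [set w : trajectory V | g (w 0%N) = g v]
      = [set w : trajectory V | w 0%N = v].
    by apply/seteqP; split => w /=; [exact: g_inj | move=> ->].
  rewrite start_law -EFinM.
  set N := [set w : trajectory V | ~ forall k, (k < p)%N -> step w k \in S].
  set F := fun l => [set w : trajectory V | w 0%N = v /\ step_word w p = l].
  have mN : measurable N.
    apply: (@measurable_determined _ _ _ p) => w w' h nS S'.
    by apply: nS => k kp; rewrite /step !h ?(ltnW kp) //; exact: S'.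
  have mF l : measurable (F l) by exact: measurable_start_word.
  have mU : measurable (\big[setU/set0]_(l <- words S p | Q l) F l).
    exact: bigsetU_measurable.
  (* Off the null event [N] all steps are in [S], and the word of steps is one of the finitely many
     in [words S p]. *)
  apply: (@le_trans _ _ (P (N `|` \big[setU/set0]_(l <- words S p | Q l) F l))).
    apply: le_measure; rewrite ?inE.
    - apply: measurableI => //.
      by apply: (@measurable_determined _ _ _ 0) => w w' h /=; rewrite h.
    - exact: measurableU.
    move=> w [Ew wv].
    have [wS|] := pselect (forall k, (k < p)%N -> step w k \in S); last by left.
    right; rewrite -bigcup_seq_cond; exists (step_word w p) => //=.
    by rewrite mem_words.
  have PN : P N = 0%E := steps_not_in_S p.
  apply: (le_trans (measureU2 P mN mU)); rewrite [X in (X + _)%E]PN add0e.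
  apply: (le_trans (measure_bigsetU_le P _ _ mF)).
  apply: (@le_trans _ _
    (\sum_(l <- words S p | Q l) (retr (word_block L (rho v) l))%:E)%E).
    by apply: lee_sum => l _; exact: start_word_le.
  by rewrite sumEFin lee_fin.
have disj : trivIset setT (fun j => [set w : trajectory V | g (w 0%N) = j]).
  by apply/trivIsetP => i j _ _ /eqP ij; apply/seteqP; split => // w /= [->].
have -> : E = \bigcup_j (E `&` [set w : trajectory V | g (w 0%N) = j]).
  by apply/seteqP; split => [w Ew|w [j _ []]//]; exists (g (w 0%N)).
rewrite measure_bigcup //; last 2 first.
- by move=> j _; exact: measurableI.
- exact: trivIset_setIl.
apply: (@le_trans _ _
  (\sum_(j <oo | j \in setT) c%:E * P [set w | g (w 0%N) = j])%E).
  by apply: lee_nneseries => j *; [exact: measure_ge0 | exact: start_le].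
(* The starting events partition the space, so their probabilities sum to 1. *)
have cover : \bigcup_j [set w : trajectory V | g (w 0%N) = j] = setT.
  by apply/seteqP; split => // w _; exists (g (w 0%N)).
rewrite nneseriesZl // -measure_bigcup // cover.
by rewrite [X in (_ * X)%E](probability_setT P) mule1.
Qed.

End PositionLaw.

(** * Euclidean norm, coordinates and a geometric series *)

Section Norms.
Variables (R : realType) (d : nat).
Implicit Types x : 'rV[R]_d.

(** If all coordinates were at most [eps / (d + 1)] in absolute value, the squared norm would be at
    most [d eps^2 / (d + 1)^2], hence at most [eps^2]. Using d + 1 rather than d also covers
    dimension 0; [b] records the sign of the coordinate. *)
Lemma enorm_gt_coord (eps : R) x : 0 < eps -> eps < enorm x ->
  exists j (b : bool), eps / d.+1%:R < (-1) ^+ b * x 0 j.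
Proof.
move=> eps_gt0 big_x; apply: contrapT => none.
set e := eps / d.+1%:R in none.
have e_ge0 : 0 <= e by rewrite divr_ge0 // ltW.
have x_le j : `|x 0 j| <= e.
  rewrite leNgt; apply/negP => xj; apply: none; exists j, (x 0 j < 0).
  by rewrite -normrEsign.
move: big_x; apply/negP; rewrite -leNgt /enorm -(gtr0_norm eps_gt0).
rewrite -sqrtr_sqr ler_wsqrtr //.
apply: (@le_trans _ _ (\sum_(j < d) e ^+ 2)).
  by apply: ler_sum => j _; rewrite -real_normK ?num_real // lerXn2r ?nnegrE.
rewrite sumr_const card_ord.
have -> : eps = d.+1%:R * e by rewrite /e mulrCA divff ?mulr1 ?pnatr_eq0.
rewrite (exprMn _ _ e) -[e ^+ 2 *+ d]mulr_natl ler_wpM2r ?sqr_ge0 //.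
by rewrite -natrX ler_nat expnS expn1 mulnS (leq_trans (leqnSn d)) // leq_addr.
Qed.

(** Convergence in ['rV[R]_d] refers to the sup norm, whereas deviations are measured in the
    Euclidean one. *)
Lemma norm_le_enorm x : `|x| <= enorm x.
Proof.
rewrite [leLHS]mx_normrE; apply: bigmax_le => [|[i j] _ /=]; first exact: sqrtr_ge0.
rewrite (ord1 i) -sqrtr_sqr ler_wsqrtr // (bigD1 j) //= lerDl.
by apply: sumr_ge0 => k _; exact: sqr_ge0.
Qed.

End Norms.

Lemma nneseries_expR_lty (R : realType) (N : R) : 0 < N ->
  (\sum_(p <oo) (expR (- (p%:R * N)))%:E < +oo)%E.
Proof.
move=> N_gt0.
have z_lt1 : `|expR (- N)| < 1.
  by rewrite ger0_norm ?expR_ge0 // -expR0 ltr_expR oppr_lt0.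
have cvg_z := @is_cvg_geometric_series R 1 _ z_lt1.
rewrite (_ : (fun n => _) = EFin \o series (geometric 1 (expR (- N)))).
  by rewrite EFin_lim // ltry.
apply/funext => n; rewrite /= /series /= -sumEFin; apply: eq_bigr => p _.
by rewrite /geometric /= mul1r -mulrN mulrC expRM_natr.
Qed.

(** * Deviations of the mean position *)

Section MainEstimates.
Variables (R : realType) (d n : nat) (V : lattice R d) (S : {fset 'rV[R]_d}).
Variable L : 'rV[R]_d -> 'M[R[i]]_n.
Hypothesis n_gt0 : (0 < n)%N.
Hypothesis L_norm : \sum_(s <- S) (L s) ^t* *m L s = 1%:M.
Hypothesis L_irr : irreducible (auxiliary_map S L).
Variable rho_inv : 'M[R[i]]_n.
Hypothesis rho_inv_state : is_state rho_inv.
Hypothesis rho_inv_fixed : auxiliary_map S L rho_inv = rho_inv.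
Variable rho : vertex V -> 'M[R[i]]_n.
Hypothesis rho_ge0 : forall v, positive_op (rho v).
Variable P : probability (trajectory V) R.
Hypothesis P_law : position_law S L rho P.

Let m := mean_drift S L rho_inv.

(** The hypothesis says that [f] has mean zero under the invariant state, which is the solvability
    condition of the Poisson equation. *)
Lemma poisson_solution (f : 'rV[R]_d -> R) :
    \sum_(s <- S) f s * retr (L s *m rho_inv *m (L s) ^t*) = 0 ->
  exists Y, Y - dual_map S L Y = \sum_(s <- S) (f s)%:C *: ((L s) ^t* *m L s).
Proof.
move=> f0; apply: (@poisson_equation _ _ _ S L n_gt0 L_norm _ rho_inv).
- by move=> Q; exact: irreducible_invariant.
- by case: rho_inv_state => _ ->; apply/eqP/oner_neq0.
- exact: rho_inv_fixed.
rewrite mulmx_sumr raddf_sum /=.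
transitivity ((\sum_(s <- S) f s * retr (L s *m rho_inv *m (L s) ^t*))%:C).
  rewrite rmorph_sum; apply: eq_bigr => s _.
  rewrite -scalemxAr mxtraceZ rmorphM /=; congr (_ * _).
  rewrite mulmxA mxtrace_mulC mulmxA.
  have psd := positive_op_conj (L s) (proj1 rho_inv_state).
  (* A positive operator has a real trace, so the hypothesis on real parts gives the complex
     identity. *)
  have : complex.Im (\tr (L s *m rho_inv *m (L s) ^t*)) = 0.
    rewrite /mxtrace; elim/big_ind: _ => // [[a b] [a' b'] /= -> ->|i _].
      by rewrite addr0.
    by have [] := positive_op_diag i psd.
  by rewrite /retr; case: (\tr _) => a b /= ->.
by rewrite f0.
Qed.

Lemma drift_chernoff (f : 'rV[R]_d -> R) (e : R) : 0 < e ->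
    \sum_(s <- S) f s * retr (L s *m rho_inv *m (L s) ^t*) = 0 ->
  exists2 N : R, 0 < N & forall p,
    (P [set w : trajectory V | (p%:R * e < \sum_(s <- step_word w p) f s)%R]
       <= (4 * expR (- (p%:R * N)))%:E)%E.
Proof.
move=> e_gt0 /poisson_solution [Y eY].
have [N N_gt0 hN] := word_chernoff L_norm eY e_gt0.
exists N => // p.
apply: (word_event_le rho_ge0 P_law (Q := fun l => p%:R * e < \sum_(s <- l) f s)).
  by rewrite mulr_ge0 ?expR_ge0.
by move=> v; exact: hN.
Qed.

Lemma sum_coord_drift j (b : bool) :
  \sum_(s <- S) (-1) ^+ b * (s 0 j - m 0 j)
     * retr (L s *m rho_inv *m (L s) ^t*) = 0.
Proof.
have tot : \sum_(s <- S) retr (L s *m rho_inv *m (L s) ^t*) = 1.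
  rewrite -retr_sum -/(auxiliary_map S L rho_inv) rho_inv_fixed /retr.
  by case: rho_inv_state => _ ->.
under eq_bigr do rewrite -mulrA mulrBl mulrBr.
rewrite sumrB -!mulr_sumr tot mulr1 -mulrBr.
rewrite [X in X - _](_ : _ = m 0 j) ?subrr ?mulr0 //.
by rewrite /m /mean_drift summxE; apply: eq_bigr => s _; rewrite !mxE mulrC.
Qed.

(** For [p] equal to 0 the inverse is 0 by convention and the value is [- m], whence the condition
    [0 < p] in the estimates. *)
Definition deviation p (w : trajectory V) : 'rV[R]_d :=
  p%:R^-1 *: (X p w - X 0 w) - m.

Lemma deviation_coord p (w : trajectory V) j (b : bool) : (0 < p)%N ->
  p%:R * ((-1) ^+ b * deviation p w 0 j)
    = \sum_(s <- step_word w p) (-1) ^+ b * (s 0 j - m 0 j).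
Proof.
move=> p_gt0; rewrite -mulr_sumr mulrCA; congr (_ * _).
rewrite sumrB -summxE step_word_sum big_const_seq count_predT size_step_word.
rewrite iter_addr_0 /deviation /X !mxE mulrBr mulrA divff ?mul1r ?mulr_natl //.
by rewrite pnatr_eq0 -lt0n.
Qed.

Lemma measurable_deviation eps p :
  measurable ([set w | eps < enorm (deviation p w)] : set (trajectory V)).
Proof.
apply: (@measurable_determined _ _ _ p) => w w' h /=.
by rewrite /deviation /X !h.
Qed.

(** Union bound over the 2d signed coordinates, each contributing a factor 4. *)
Lemma deviation_le (eps : R) : 0 < eps -> exists2 N : R, 0 < N &
  forall p, (0 < p)%N ->
    (P [set w : trajectory V | (eps < enorm (deviation p w))%R]
       <= ((8 * d)%:R * expR (- (p%:R * N)))%:E)%E.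
Proof.
move=> eps_gt0; pose e := eps / d.+1%:R.
have e_gt0 : 0 < e by rewrite divr_gt0.
have /choice [N hN] : forall jb : 'I_d * bool, exists N, 0 < N /\ forall p,
    (P [set w : trajectory V | (p%:R * e < \sum_(s <- step_word w p)
                             (-1) ^+ jb.2 * (s 0 jb.1 - m 0 jb.1))%R]
       <= (4 * expR (- (p%:R * N)))%:E)%E.
  move=> [j b].
  by have [N N_gt0 hN] := drift_chernoff e_gt0 (sum_coord_drift j b); exists N.
(* The smallest of the finitely many rates; the default 1 keeps it positive when [d] is 0. *)
pose N0 := \big[Num.min/1]_jb N jb.
have N0_gt0 : 0 < N0.
  apply: (big_ind (fun x => 0 < x)) => // [x y x0 y0|i _].
    by rewrite lt_min x0.
  by have [] := hN i.
exists N0 => // p p_gt0.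
pose F (jb : 'I_d * bool) := [set w : trajectory V |
  p%:R * e < \sum_(s <- step_word w p) (-1) ^+ jb.2 * (s 0 jb.1 - m 0 jb.1)].
have mF jb : measurable (F jb).
  apply: (@measurable_determined _ _ _ p) => w w' h.
  by rewrite /F /= (step_word_agree h).
apply: (@le_trans _ _ (P (\big[setU/set0]_jb F jb))).
  apply: le_measure; rewrite ?inE.
  - exact: measurable_deviation.
  - exact: bigsetU_measurable.
  move=> w /= /(enorm_gt_coord eps_gt0) [j [b hjb]].
  rewrite -bigcup_seq_cond; exists (j, b) => /=; first by rewrite mem_index_enum.
  by rewrite /F /= -deviation_coord // ltr_pM2l // ltr0n.
apply: (le_trans (measure_bigsetU_le P _ _ mF)).
apply: (@le_trans _ _ (\sum_(jb : 'I_d * bool) (4 * expR (- (p%:R * N0)))%:E)%E).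
  apply: lee_sum => jb _; apply: (le_trans (proj2 (hN jb) p)).
  rewrite lee_fin ler_pM2l // ler_expR lerN2 ler_wpM2l //.
  by rewrite /N0 (bigD1 jb) //= ge_min lexx.
rewrite sumEFin lee_fin sumr_const card_prod card_ord card_bool.
rewrite -[leLHS]mulr_natl mulrA.
by rewrite -natrM (_ : (d * 2 * 4 = 8 * d)%N) // -mulnA mulnC.
Qed.

Lemma deviation_exponential (eps : R) : 0 < eps -> exists N : R, 0 < N /\
  \forall p \near \oo, (P [set w : trajectory V | (eps < enorm (deviation p w))%R]
                          <= (expR (- (p%:R * N)))%:E)%E.
Proof.
move=> /deviation_le [N N_gt0 hN].
(* Half of the rate absorbs the prefactor: [8 d <= p N / 2 <= expR (p N / 2)] for large [p]. *)
exists (N / 2); split; first by rewrite divr_gt0.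
near=> p.
have p_gt0 : (0 < p)%N by near: p; exact: nbhs_infty_gt.
apply: (le_trans (hN p p_gt0)); rewrite lee_fin.
have -> : expR (- (p%:R * N)) =
    expR (- (p%:R * (N / 2))) * expR (- (p%:R * (N / 2))).
  by rewrite -expRD; congr expR; field.
rewrite mulrA ger_pMl ?expR_gt0 // expRN ler_pdivrMr ?expR_gt0 // mul1r.
have : (8 * d)%:R / (N / 2) < p%:R by near: p; exact: nbhs_infty_gtr.
rewrite ltr_pdivrMr ?divr_gt0 // => /ltW/le_trans; apply.
by rewrite (le_trans _ (expR_ge1Dx _)) // lerDr.
Unshelve. all: by end_near.
Qed.

Lemma deviation_limsup0 (eps : R) : 0 < eps ->
  P (lim_sup_set
       (fun p => [set w : trajectory V | eps < enorm (deviation p w)])) = 0%E.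
Proof.
move=> /deviation_exponential [N [N_gt0 [p0 _ hN]]].
pose F p := [set w : trajectory V | eps < enorm (deviation p w)].
rewrite -/F.
have mF p : measurable (F p : set (trajectory V)) by exact: measurable_deviation.
(* The exponential bound holds only from [p0] on; shifting the sequence does not change its limsup,
   and makes the Borel-Cantelli lemma applicable. *)
have -> : lim_sup_set F = lim_sup_set (fun p => F (p + p0)%N).
  apply/seteqP; split => w h k _.
    have [q /= kq Fq] := h (k + p0)%N I; exists (q - p0)%N => /=.
      by rewrite leq_subRL ?(leq_trans (leq_addl k p0)) // addnC.
    by rewrite subnK // (leq_trans (leq_addl k p0)).
  have [q /= kq Fq] := h k I; exists (q + p0)%N => //=.
  by rewrite (leq_trans kq) // leq_addr.
apply: (@lim_sup_set_cvg0 _ (trajectory V)) => [//|].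
apply: le_lt_trans (nneseries_expR_lty N_gt0).
apply: lee_nneseries => p *; first exact: measure_ge0.
apply: (le_trans (hN (p + p0)%N _)); first exact: leq_addl.
by rewrite lee_fin ler_expR lerN2 ler_pM2r // ler_nat leq_addr.
Qed.

End MainEstimates.

(** * Almost sure convergence *)

Lemma cvg_mean_position (R : realType) (d : nat) (V : lattice R d)
    (m : 'rV[R]_d) (w : trajectory V) :
    (forall eps, 0 < eps -> \forall p \near \oo,
       enorm (p%:R^-1 *: (X p w - X 0 w) - m) <= eps) ->
  (fun p : nat => p%:R^-1 *: X p w) @ \oo --> m.
Proof.
move=> small; apply/cvgrPdist_le => eps eps_gt0; near=> p.
have p_gt0 : 0 < p%:R :> R by rewrite ltr0n; near: p; exact: nbhs_infty_gt.
have -> : m - p%:R^-1 *: X p w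
    = - (p%:R^-1 *: (X p w - X 0 w) - m) - p%:R^-1 *: X 0 w.
  by rewrite scalerBr opprB opprD opprK addrA addrK.
(* Half of [eps] is for the deviation, half for [X 0 w / p], which tends to 0 because the trajectory
   is fixed. *)
rewrite (le_trans (ler_normB _ _)) // normrN [eps]splitr lerD //.
  rewrite (le_trans (norm_le_enorm _)) //.
  by near: p; apply: small; rewrite divr_gt0.
rewrite normrZ normfV ger0_norm ?ler0n // mulrC ler_pdivrMr // mulrC.
rewrite -ler_pdivrMr ?divr_gt0 // ltW //.
by near: p; exact: nbhs_infty_gtr.
Unshelve. all: by end_near.
Qed.

Theorem corollary5p11 (R : realType) (d n : nat) (V : lattice R d)
    (S : {fset 'rV[R]_d}) (L : 'rV[R]_d -> 'M[R[i]]_n)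
    (n_gt0 : (0 < n)%N)
    (S_sub_V : forall s, s \in S -> lattice_set V s)
    (S_neq0 : S <> [fset 0]%fset)
    (S_gen : positively_generates S V)
    (L_norm : \sum_(s <- S) (L s) ^t* *m L s = 1%:M)
    (L_irr : irreducible (auxiliary_map S L))
    (rho_inv : 'M[R[i]]_n)
    (rho_inv_state : is_state rho_inv)
    (rho_inv_fixed : auxiliary_map S L rho_inv = rho_inv)
    (rho : vertex V -> 'M[R[i]]_n)
    (rho_state : diagonal_state rho)
    (P : probability (trajectory V) R)
    (P_law : position_law S L rho P) :
  (forall eps : R, 0 < eps ->
     exists N : R, 0 < N /\
       \forall p \near \oo,
         (P [set w : trajectory V |
               (eps < enorm (p%:R^-1 *: (X p w - X 0 w)
                             - mean_drift S L rho_inv))%R]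
          <= (expR (- (p%:R * N)))%:E)%E) /\
  {ae P, forall w : trajectory V,
     (fun p : nat => p%:R^-1 *: X p w) @ \oo --> mean_drift S L rho_inv}.
Proof.
have [rho_ge0 _] := rho_state.
split.
  exact: (deviation_exponential n_gt0 L_norm L_irr rho_inv_state rho_inv_fixed
            rho_ge0 P_law).
(* The countably many thresholds 1 / (k + 1) suffice, so the exceptional trajectories form a
   countable union of null sets. *)
pose E (k p : nat) := [set w : trajectory V |
  (k.+1%:R^-1 : R) < enorm (deviation S L rho_inv p w)].
have E0 : P.-negligible (\bigcup_k lim_sup_set (E k)).
  apply: negligible_bigcup => k.
  have mE : measurable (lim_sup_set (E k)).
    apply: bigcap_measurableType => i _; apply: bigcup_measurable => p _.
    exact: measurable_deviation.
  apply/(negligibleP P mE).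
  have k_gt0 : 0 < (k.+1%:R^-1 : R) by rewrite invr_gt0.
  exact: (deviation_limsup0 n_gt0 L_norm L_irr rho_inv_state rho_inv_fixed
            rho_ge0 P_law k_gt0).
apply: negligibleS E0 => w; apply: contraPP => nE; apply.
apply: cvg_mean_position => eps eps_gt0.
have [k k_eps] : exists k : nat, (k.+1%:R^-1 : R) <= eps.
  exists (Num.truncn eps^-1).
  rewrite invf_ple ?posrE // ltW //; exact: truncnS_gt.
(* If the deviation did not eventually stay below [eps], it would exceed 1 / (k + 1) infinitely
   often, placing [w] in the exceptional set. *)
apply: contrapT => not_near; apply: nE; exists k => // p0 _.
apply: contrapT => none; apply: not_near; exists p0 => // p /= p0p.
rewrite leNgt; apply/negP => big_p; apply: none; exists p => //=.
exact: le_lt_trans big_p.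
Qed.
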